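(* Let $\boldsymbol{\theta}=(\theta^{(n)})_{n\ge 0}$ be a constant-length directive sequence, defined on a sequence of alphabets $(\mathcal A_n)_{n\ge 0}$ of bounded size, with length sequence $(q_n)_{n\ge 0}$ such that $q_n\ge 2$ for infinitely many $n$, and such that each shift $(X^{(n)}_{\boldsymbol\theta},\sigma)$, $n\ge 0$, is minimal. If $\boldsymbol\theta$ is recognizable, then it is quasi-recognizable. Conversely, if $\boldsymbol\theta$ is quasi-recognizable and each morphism $\theta^{(n)}$ is injective on letters (that is, $\theta^{(n)}(a)\neq\theta^{(n)}(b)$ whenever $a\ne b$ in $\mathcal A_{n+1}$), then $\boldsymbol\theta$ is recognizable.
   Context: Alphabets are finite sets. A morphism $\theta:\mathcal A\to\mathcal B^+$ maps letters to non-empty words and is extended by concatenation to words and to $\mathcal A^{\mathbb Z}$ (with $\theta(x_0)$ starting at index $0$ of $\theta(x)$). $\sigma$ is the left shift. A directive sequence is a sequence $\boldsymbol\theta=(\theta^{(n)})_{n\ge 0}$ of morphisms $\theta^{(n)}:\mathcal A_{n+1}\to\mathcal A_n^+$; the alphabets are of bounded size if $\sup_n|\mathcal A_n|<\infty$. Put $\theta^{[n,N)}=\theta^{(n)}\circ\cdots\circ\theta^{(N-1)}$. $X^{(n)}_{\boldsymbol\theta}=X^{(n)}$ is the set of $x\in\mathcal A_n^{\mathbb Z}$ all of whose finite subwords are subwords of $\theta^{[n,N)}(a)$ for some $N>n$ and $a\in\mathcal A_N$; $X_{\boldsymbol\theta}=X^{(0)}_{\boldsymbol\theta}$. $\boldsymbol\theta$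 is constant-length with length sequence $(q_n)$ if $|\theta^{(n)}(a)|=q_n$ for all $n$ and all $a\in\mathcal A_{n+1}$. Recognizability: a (centred) $\theta$-representation of $y\in\mathcal B^{\mathbb Z}$ in $X\subseteq\mathcal A^{\mathbb Z}$ is a pair $(k,x)$ with $x\in X$, $y=\sigma^k\theta(x)$ and $0\le k<|\theta(x_0)|$. The morphism $\theta$ is recognizable in $X$ if each $y\in\mathcal B^{\mathbb Z}$ has at most one centred $\theta$-representation in $X$. $\boldsymbol\theta$ is recognizable if, for every $n\ge 0$, $\theta^{(n)}$ is recognizable in $X^{(n+1)}$. Odometer: with $p_0=1$ and $p_n=q_0\cdots q_{n-1}$, $\mathbb Z_{(q_n)}=\varprojlim \mathbb Z/p_n\mathbb Z$, a compact topological group, with the map $+1$. A factor map is a continuous surjection commuting with the dynamics. Quasi-recognizability: a constant-length $\boldsymbol\theta$ with length sequence $(q_n)$ and all $(X^{(n)}_{\boldsymbol\theta},\sigma)$ minimal is quasi-recognizable if there is a factor map $(X_{\boldsymbol\theta},\sigma)\to(\mathbb Z_{(q_n)},+1)$. *)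

(* Defs.v *)
From HB Require Import structures.
From mathcomp Require Import all_boot all_order all_algebra.
From mathcomp Require Import all_classical topology.

Set Implicit Arguments.
Unset Strict Implicit.
Unset Printing Implicit Defensive.

Import GRing.Theory.

Local Open Scope classical_set_scope.
Local Open Scope ring_scope.

Record morphism (A B : finType) := Morphism {
  morphism_fun :> A -> seq B;
  morphism_gt0 : forall a, (0 < size (morphism_fun a))%N }.

Definition on_words (A B : finType) (theta : A -> seq B) (w : seq A) : seq B :=
  flatten [seq theta a | a <- w].

Definition first_letter (A B : finType) (theta : morphism A B) (a : A) : B :=
  tnth (in_tuple (theta a)) (Ordinal (morphism_gt0 theta a)).

Definition fullshift (A : finType) : Type :=
  prod_topology (fun _ : int => discrete_topology A).

HB.instance Definition _ (A : finType) := Topological.copy (fullshift A)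
  (prod_topology (fun _ : int => discrete_topology A)).

Definition shift {A : finType} (x : fullshift A) : fullshift A :=
  fun i => x (i + 1).

(* x_m x_(m+1) ... x_(m+l-1) *)
Definition factor (A : finType) (x : fullshift A) (m : int) (l : nat) : seq A :=
  [seq x (m + k%:Z) | k <- iota 0 l].

(* theta(x), with theta(x_0) starting at index 0. As theta is non-erasing, the
   letter at index i >= 0 lies in theta(x_0 ... x_i), and the letter at index
   -(i+1), which is Negz i, is the (i+1)-st from the end of
   theta(x_(-(i+1)) ... x_(-1)); both uses of nth are thus within bounds, and
   the default letter is irrelevant. *)
Definition on_sequences (A B : finType) (theta : morphism A B)
    (x : fullshift A) : fullshift B :=
  fun i => let d := first_letter theta (x 0) in
  match i with
  | Posz i => nth d (on_words theta (factor x 0 i.+1)) i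
  | Negz i => let w := on_words theta (factor x (Negz i) i.+1) in
              nth d w (size w - i.+1)
  end.

Definition minimal (A : finType) (X : set (fullshift A)) : Prop :=
  X !=set0 /\
  forall Y : set (fullshift A),
    Y `<=` X -> closed Y -> @shift A @` Y = Y -> Y !=set0 -> Y = X.

Definition centred_representation (A B : finType) (theta : morphism A B)
    (X : set (fullshift A)) (y : fullshift B) (kx : nat * fullshift A) : Prop :=
  [/\ X kx.2, y = iter kx.1 (@shift B) (on_sequences theta kx.2)
    & (kx.1 < size (theta (kx.2 0)))%N].

Definition recognizable_in (A B : finType) (theta : morphism A B)
    (X : set (fullshift A)) : Prop :=
  forall (y : fullshift B) (kx kx' : nat * fullshift A),
    centred_representation theta X y kx ->
    centred_representation theta X y kx' -> kx = kx'.

Definition directive_sequence (A : nat -> finType) : Type :=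
  forall n, morphism (A n.+1) (A n).

(* theta^[n, k+n) on letters. The upper index is k + n rather than n + k so that
   A (k.+1 + n) is convertible to A (k + n).+1. *)
Fixpoint block (A : nat -> finType) (theta : directive_sequence A) (n k : nat) :
    A (k + n)%N -> seq (A n) :=
  match k with
  | 0 => fun a => [:: a]
  | k'.+1 => fun a => on_words (@block A theta n k') (theta (k' + n)%N a)
  end.

Definition level_shift (A : nat -> finType) (theta : directive_sequence A)
    (n : nat) : set (fullshift (A n)) :=
  [set x | forall (m : int) (l : nat), exists (k : nat) (a : A (k + n)%N),
     (0 < k)%N /\ infix (factor x m l) (block theta a)].

Arguments level_shift {A} theta n.

Definition recognizable (A : nat -> finType) (theta : directive_sequence A) :
    Prop :=
  forall n, recognizable_in (theta n) (level_shift theta n.+1).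

Definition constant_length (A : nat -> finType) (theta : directive_sequence A)
    (q : nat -> nat) : Prop :=
  forall n (a : A n.+1), size (theta n a) = q n.

Definition bounded_alphabets (A : nat -> finType) : Prop :=
  exists K : nat, forall n, (#|A n| <= K)%N.

Definition period (q : nat -> nat) (n : nat) : nat := (\prod_(i < n) q i)%N.

Definition residues (q : nat -> nat) : Type :=
  prod_topology (fun n : nat => discrete_topology 'I_(period q n)).

HB.instance Definition _ (q : nat -> nat) := Topological.copy (residues q)
  (prod_topology (fun n : nat => discrete_topology 'I_(period q n))).

(* The inverse limit of the Z/p_n Z, as a subspace of their product, with
   Z/p_n Z carried by 'I_(p_n) (and not 'Z_(p_n), since p_n may be 1). *)
Definition odometer (q : nat -> nat) : set (residues q) :=
  [set z | forall n, (z n.+1 %% period q n)%N = z n].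

Arguments odometer q : clear implicits.

Definition add_one (q : nat -> nat) (z : residues q) : residues q :=
  fun n => ordS (z n).

(* A map on X is given by a total function, whose values outside X play no
   role. *)
Definition factor_map (T U : topologicalType) (X : set T) (S : T -> T)
    (Y : set U) (R : U -> U) (f : T -> U) : Prop :=
  [/\ {within X, continuous f}, f @` X = Y
    & forall x, X x -> f (S x) = R (f x)].

Definition quasi_recognizable (A : nat -> finType)
    (theta : directive_sequence A) (q : nat -> nat) : Prop :=
  exists f : fullshift (A 0%N) -> residues q,
    factor_map (level_shift theta 0%N) (@shift (A 0%N))
               (odometer q) (@add_one q) f.

(* Main.v *)
Require Import Defs.
From mathcomp Require Import all_boot all_order all_algebra.
From mathcomp Require Import all_classical topology.
From mathcomp Require Import zify ring.

(** Let p_n = q_0 ... q_(n-1), and let C_n be the image of X^(n) under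
    theta^[0,n). By minimality of X^(0), the shifts sigma^r C_n with r < p_n
    cover X^(0). If theta is recognizable they are pairwise disjoint, and
    sending y to the family of the r < p_n such that y lies in sigma^r C_n is a
    factor map; it is onto the odometer by compactness. Conversely, the n-th
    coordinate of a factor map f, composed with theta^[0,n), is shift-invariant
    and continuous on the minimal shift X^(n), hence constant. So f at level
    n + 1 determines the exponent k of a theta^(n)-representation, after applying
    theta^[0,n), and injectivity on letters determines the sequence. *)

Set Implicit Arguments.
Unset Strict Implicit.
Unset Printing Implicit Defensive.

Import Order.TTheory GRing.Theory Num.Theory.

Local Open Scope classical_set_scope.
Local Open Scope ring_scope.

(* set_interval also defines a [factor]. *)
Local Notation factor := Defs.factor.

(** * Constant-length morphisms on words and on two-sided sequences *)

Section ConstantLength.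
Variables (A B : finType) (theta : morphism A B) (q : nat).
Hypothesis size_theta : forall a, size (theta a) = q.

Lemma size_on_words w : size (on_words theta w) = (size w * q)%N.
Proof. by elim: w => //= a w IHw; rewrite size_cat size_theta IHw mulSn. Qed.

Lemma nth_on_words a0 d w i j : (i < size w)%N -> (j < q)%N ->
  nth d (on_words theta w) (i * q + j) = nth d (theta (nth a0 w i)) j.
Proof.
move=> + jq; elim: w i => //= a w IHw [|i] iw.
  by rewrite mul0n add0n /on_words/= nth_cat size_theta jq.
rewrite /on_words/= nth_cat size_theta mulSn -addnA.
by rewrite ltnNge leq_addr /= addKn IHw.
Qed.

Lemma size_factor (x : fullshift A) (m : int) l : size (factor x m l) = l.
Proof. by rewrite size_map size_iota. Qed.

Lemma nth_factor a0 (x : fullshift A) (m : int) l i : (i < l)%N ->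
  nth a0 (factor x m l) i = x (m + i%:Z).
Proof. by move=> il; rewrite (nth_map 0%N) ?size_iota// nth_iota. Qed.

Hypothesis q_gt0 : (0 < q)%N.

Lemma nth_on_words_factor d (x : fullshift A) (m : int) l t : (t < l * q)%N ->
  nth d (on_words theta (factor x m l)) t =
  nth d (theta (x (m + (t %/ q)%N))) (t %% q).
Proof.
move=> tl; rewrite {1}(divn_eq t q) (nth_on_words (x 0)) ?ltn_pmod ?size_factor//.
  by rewrite nth_factor // ltn_divLR.
by rewrite ltn_divLR.
Qed.

(** Division rounding down treats both signs of [i] alike and replaces the two cases of
    [on_sequences]. The remainder is below [q], so the default [d] is arbitrary. *)
Lemma on_sequencesE d (x : fullshift A) (i : int) :
  on_sequences theta x i = nth d (theta (x (i %/ q)%Z)) `|(i %% q)%Z|.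
Proof.
have q0 : (q : int) != 0 by rewrite -lt0n.
case: i => i; rewrite /on_sequences.
  rewrite nth_on_words_factor; last by nia.
  rewrite add0r divz_nat modz_nat absz_nat; apply: set_nth_default.
  by rewrite size_theta ltn_pmod.
rewrite size_on_words size_factor nth_on_words_factor; last by nia.
set t := (_ - _)%N.
(* The word read here starts at index -(i+1)q of theta(x), and [t] is the offset of index -(i+1)
   from that start. *)
have Et : Negz i = (Negz i + (t %/ q)%N) * q + (t %% q)%N.
  have : t%:Z = (t %/ q)%N%:Z * q + (t %% q)%N%:Z by rewrite {1}(divn_eq t q).
  have : t%:Z = i.+1%:Z * q - i.+1%:Z by rewrite /t; nia.
  rewrite NegzE mulrDl -addrA => -> <-; ring.
rewrite [in RHS]Et divzMDl// modzMDl divz_small ?modz_small ?addr0 ?absz_nat;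
  last 2 first.
- by rewrite lez_nat leq0n /= ltz_nat ltn_pmod.
- by rewrite lez_nat leq0n /= ltz_nat ltn_pmod.
by apply: set_nth_default; rewrite size_theta ltn_pmod.
Qed.

Lemma on_sequences_mulD d (x : fullshift A) (i : int) (j : nat) : (j < q)%N ->
  on_sequences theta x (i * q + j) = nth d (theta (x i)) j.
Proof.
move=> jq; have q0 : (q : int) != 0 by rewrite -lt0n.
have jr : 0 <= j%:Z < q%:Z by rewrite lez_nat leq0n ltz_nat.
by rewrite (on_sequencesE d) divzMDl// modzMDl divz_small ?modz_small ?addr0.
Qed.
End ConstantLength.

(** * Topology of products of discrete spaces and of full shifts *)

(** The product topology is the supremum of the topologies induced by the projections, so each
    coordinate can be treated alone. This is the continuity criterion used for the shift, for
    morphisms and for maps into the odometer. *)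
Lemma cvg_to_discrete_product (T : Type) (I : eqType) (K : I -> choiceType)
    (F : set_system T) (FF : Filter F)
    (g : T -> prod_topology (fun i => discrete_topology (K i)))
    (f : prod_topology (fun i => discrete_topology (K i))) :
  (forall i, \forall t \near F, g t i = f i) -> g @ F --> f.
Proof.
move=> gf; apply/cvg_sup => i U [V [[W] oW <-] Wf VU].
by apply: filterS (gf i) => t gti; apply: VU; rewrite /= /proj gti.
Qed.

Lemma near_coordinate (I : eqType) (K : I -> choiceType)
    (f : prod_topology (fun i => discrete_topology (K i))) (i : I) :
  \forall g \near f, g i = f i.
Proof.
have := @proj_continuous I (fun i => discrete_topology (K i)) i f.
by move/(_ _ (discrete_set1 (f i : discrete_topology (K i)))).
Qed.

Lemma near_letter (A : finType) (x : fullshift A) (i : int) :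
  \forall y \near x, y i = x i.
Proof. exact: (near_coordinate (K := fun=> A)). Qed.

Lemma compact_fullshift (A : finType) : compact [set: fullshift A].
Proof.
have letters_compact : compact [set: discrete_topology A].
  by apply: finite_compact; exact: finite_finset.
have := @tychonoff int _ _ (fun=> letters_compact).
by congr (compact _); apply/seteqP; split.
Qed.

Lemma hausdorff_fullshift (A : finType) : hausdorff_space (fullshift A).
Proof.
apply: (@hausdorff_product int (fun=> discrete_topology A)) => _.
exact: discrete_hausdorff.
Qed.

Lemma near_factor (A : finType) (x : fullshift A) (m : int) l :
  \forall y \near x, factor y m l = factor x m l.
Proof.
have : \forall y \near x, forall i : 'I_l, y (m + i%:Z) = x (m + i%:Z).
  apply: (@filter_forall _ _ (fun i : 'I_l =>
    [set y : fullshift A | y (m + i%:Z) = x (m + i%:Z)]) (nbhs x) _) => i.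
  exact: near_letter.
apply: filterS => y yx; apply/eq_in_map => i; rewrite mem_iota add0n.
by move=> /= il; exact: (yx (Ordinal il)).
Qed.

Lemma continuous_shift (A : finType) : continuous (@shift A).
Proof.
move=> x; apply: (@cvg_to_discrete_product _ _ (fun=> A) (nbhs x) (nbhs_filter x)) => i.
exact: near_letter.
Qed.

Lemma continuous_on_sequences (A B : finType) (theta : morphism A B) q :
  (forall a, size (theta a) = q) -> continuous (on_sequences theta).
Proof.
move=> size_theta x.
apply: (@cvg_to_discrete_product _ _ (fun=> B) (nbhs x) (nbhs_filter x)) => i.
have q_gt0 : (0 < q)%N by rewrite -(size_theta (x 0)) morphism_gt0.
have := near_letter x (i %/ q)%Z.
apply: filterS => y yx.
by rewrite !(on_sequencesE size_theta q_gt0 (first_letter theta (x 0))) yx.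
Qed.

(** * Iterates of the shift *)

Lemma iter_shiftE (A : finType) k (x : fullshift A) (i : int) :
  iter k (@shift A) x i = x (i + k%:Z).
Proof.
elim: k i => [|k IHk] i; first by rewrite addr0.
by rewrite iterS /shift IHk -addrA intS.
Qed.

Lemma factor_cat (A : finType) (x : fullshift A) (m : int) k l :
  factor x m (k + l) = factor x m k ++ factor x (m + k%:Z) l.
Proof.
rewrite /factor iotaD map_cat add0n -[in iota k l](addn0 k) iotaDl -map_comp.
by congr (_ ++ _); apply: eq_map => i /=; rewrite PoszD addrA.
Qed.

Lemma factor_iter_shift (A : finType) (x : fullshift A) k (m : int) l :
  factor (iter k (@shift A) x) m l = factor x (m + k%:Z) l.
Proof. by apply: eq_map => i; rewrite iter_shiftE addrAC. Qed.

Lemma continuous_iter_shift (A : finType) k : continuous (iter k (@shift A)).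
Proof.
elim: k => [|k IHk] x; first exact: cvg_id.
by apply: continuous_comp; [exact: IHk|exact: continuous_shift].
Qed.

Lemma iter_shift_inj (A : finType) k : injective (iter k (@shift A)).
Proof.
move=> x y xy; apply: funext => i.
by rewrite -(subrK k%:Z i) -!iter_shiftE xy.
Qed.

(** * Constant-length morphisms and the shift *)

Section ConstantLengthShift.
Variables (A B : finType) (theta : morphism A B) (q : nat).
Hypothesis size_theta : forall a, size (theta a) = q.
Hypothesis q_gt0 : (0 < q)%N.

Lemma factor_on_sequences (x : fullshift A) (m : int) l :
  factor (on_sequences theta x) (m * q) (l * q) = on_words theta (factor x m l).
Proof.
have d := first_letter theta (x 0).
apply: (@eq_from_nth _ d).
  by rewrite (size_on_words size_theta) !size_factor.
move=> i; rewrite size_factor => il; rewrite nth_factor//.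
rewrite (nth_on_words_factor size_theta q_gt0)//.
rewrite -(on_sequences_mulD size_theta q_gt0) ?ltn_pmod//.
congr on_sequences; rewrite {1}(divn_eq i q) PoszD PoszM; ring.
Qed.

Lemma on_sequences_shift (x : fullshift A) :
  on_sequences theta (shift x) = iter q (@shift B) (on_sequences theta x).
Proof.
apply: funext => i; rewrite iter_shiftE.
have q0 : (q : int) != 0 by rewrite -lt0n.
rewrite !(on_sequencesE size_theta q_gt0 (first_letter theta (x 0))).
have -> : i + q%:Z = 1 * q%:Z + i by rewrite mul1r addrC.
by rewrite divzMDl// modzMDl addrC.
Qed.

(** The window of length [q] at index i q of the image is theta(x_i), which determines x_i. *)
Lemma on_sequences_inj : injective theta -> injective (on_sequences theta).
Proof.
move=> theta_inj x y xy; apply: funext => i; apply: theta_inj.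
pose d := first_letter theta (x 0).
apply: (@eq_from_nth _ d); first by rewrite !size_theta.
move=> j; rewrite size_theta => jq.
by rewrite -!(on_sequences_mulD size_theta q_gt0)// xy.
Qed.

End ConstantLengthShift.

(** * The shifts X^(n): invariance, compactness, passage from level n + 1 to level n *)

Section LevelShift.
Variables (A : nat -> finType) (theta : directive_sequence A) (q : nat -> nat).

Lemma level_shift_shift n (x : fullshift (A n)) :
  level_shift theta n (shift x) <-> level_shift theta n x.
Proof.
split=> Xx m l.
  by have := Xx (m - 1) l; rewrite (factor_iter_shift x 1) subrK.
by rewrite (factor_iter_shift x 1).
Qed.

Lemma level_shift_iter_shift n k (x : fullshift (A n)) :
  level_shift theta n (iter k (@shift _) x) <-> level_shift theta n x.
Proof. by elim: k => //= k IHk; rewrite level_shift_shift. Qed.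

Lemma closed_level_shift n : closed (level_shift theta n).
Proof.
move=> x Xx m l; have [y [Xy <-]] := Xx _ (near_factor x m l).
exact: Xy.
Qed.

Lemma compact_level_shift n : compact (level_shift theta n).
Proof.
apply: subclosed_compact (@compact_fullshift _) _ => //.
exact: closed_level_shift.
Qed.

Lemma infix_on_words (B C : finType) (tau : B -> seq C) (v w : seq B) :
  infix v w -> infix (on_words tau v) (on_words tau w).
Proof.
move=> /infixP[u [u' ->]]; apply/infixP.
by exists (on_words tau u), (on_words tau u'); rewrite /on_words !map_cat !flatten_cat.
Qed.

Lemma on_words_on_words (B C D : finType) (tau : B -> seq C) (tau' : C -> seq D) w :
  on_words tau' (on_words tau w) = on_words (on_words tau' \o tau) w.
Proof.
elim: w => //= b w IHw; rewrite /on_words/= map_cat flatten_cat.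
by congr (_ ++ _); exact: IHw.
Qed.

(** Transport between equal levels commutes with the morphisms. Keeping [e] and [e'] as independent
    variables allows [e] to be eliminated, after which [e'] is trivial by uniqueness of identity
    proofs. *)
Lemma on_words_ecast m m' (e : m = m') (e' : m.+1 = m'.+1) (B : finType)
    (tau : A m' -> seq B) (a : A m.+1) :
  on_words tau (theta m' (ecast i (A i) e' a)) =
  on_words (fun b => tau (ecast i (A i) e b)) (theta m a).
Proof. by case: m' / e e' tau => e' tau; rewrite (eq_irrelevance e' erefl). Qed.

(** [block] recurses on its topmost morphism, whereas here a morphism is added at the bottom. The
    two index types are only propositionally equal, hence the cast. *)
Lemma on_words_block n k (a : A (k + n.+1)%N) :
  on_words (theta n) (block theta a) =
  block theta (ecast m (A m) (addnS k n) a : A (k.+1 + n)%N).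
Proof.
elim: k a => [|k IHk] a.
  rewrite (eq_irrelevance (addnS 0 n) erefl)/= /on_words/= cats0.
  by elim: (theta n a) => //= b w {1}->.
rewrite [block theta a]/= on_words_on_words.
rewrite [RHS]/= (on_words_ecast (addnS k n)).
by congr flatten; apply: eq_map => b; exact: IHk.
Qed.

Hypothesis q_gt0 : forall n, (0 < q n)%N.
Hypothesis size_theta : constant_length theta q.

(** A window of length [l] at [m] starts at offset r < q_n in the image of the letter at m div q_n.
    Since r + l <= (l + 1) q_n, the images of [l.+1] letters contain it. *)
Lemma level_shift_on_sequences n x :
  level_shift theta n.+1 x -> level_shift theta n (on_sequences (theta n) x).
Proof.
move=> Xx m l.
have [k [a [_ xa]]] := Xx (m %/ q n)%Z l.+1.
exists k.+1, (ecast i (A i) (addnS k n) a); split=> //.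
apply: infix_trans (_ : infix _ (on_words (theta n) (block theta a))) _; last first.
  by rewrite on_words_block infix_refl.
apply: infix_trans (infix_on_words (theta n) xa).
rewrite -(factor_on_sequences (@size_theta n) (q_gt0 n)).
set r := `|(m %% q n)%Z|%N.
have q0 : (q n : int) != 0 by rewrite -lt0n.
have rE : r%:Z = (m %% q n)%Z by rewrite gez0_abs ?modz_ge0.
have rq : (r < q n)%N by rewrite -ltz_nat rE ltz_pmod// ltz_nat.
have -> : (l.+1 * q n = r + (l + (l.+1 * q n - r - l)))%N by nia.
rewrite factor_cat factor_cat rE -divz_eq.
by apply/infixP; eexists; eexists.
Qed.

End LevelShift.

(** * Iterated addition of one in the odometer *)

Lemma iter_ordS p k (i : 'I_p) : iter k (@ordS p) i = ((i + k) %% p)%N :> nat.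
Proof.
elim: k => [|k IHk] /=; first by rewrite addn0 modn_small.
by rewrite IHk -addn1 modnDml addn1 addnS.
Qed.

Lemma iter_add_one q k (z : residues q) n :
  iter k (@add_one q) z n = iter k (@ordS _) (z n).
Proof. by elim: k => //= k <-. Qed.

(** * Towers: the shifted images sigma^r C_n *)

Section Towers.
Variables (A : nat -> finType) (theta : directive_sequence A) (q : nat -> nat).
Hypothesis size_theta : constant_length theta q.
Hypothesis q_gt0 : forall n, (0 < q n)%N.

(* theta^[0, n) on sequences *)
Fixpoint on_sequences_upto n : fullshift (A n) -> fullshift (A 0) :=
  match n with
  | 0 => id
  | m.+1 => fun x => on_sequences_upto (on_sequences (theta m) x)
  end.

Lemma periodS n : period q n.+1 = (period q n * q n)%N.
Proof. by rewrite /period big_ord_recr. Qed.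

Lemma period_gt0 n : (0 < period q n)%N.
Proof. by rewrite /period prodn_gt0. Qed.

Lemma dvdn_period n k : (period q n %| period q (n + k))%N.
Proof.
by elim: k => [|k IHk]; rewrite ?addn0// addnS periodS dvdn_mulr.
Qed.

Lemma on_sequences_iter_shift n k x :
  on_sequences (theta n) (iter k (@shift _) x) =
  iter (k * q n) (@shift _) (on_sequences (theta n) x).
Proof.
elim: k => [|k IHk]; first by rewrite mul0n.
rewrite iterS (on_sequences_shift (@size_theta n))// IHk.
by rewrite mulSn iterD.
Qed.

Lemma on_sequences_upto_iter_shift n k x :
  on_sequences_upto (iter k (@shift (A n)) x) =
  iter (k * period q n) (@shift _) (on_sequences_upto x).
Proof.
elim: n k x => [|n IHn] k x; first by rewrite /period big_ord0 muln1.
by rewrite /= on_sequences_iter_shift IHn periodS mulnAC mulnA.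
Qed.

(** In the Euclidean division of [k] by p_n, the quotient counts whole blocks, which become shifts
    at level n. *)
Lemma iter_shift_on_sequences_upto n k x :
  iter k (@shift _) (on_sequences_upto x) =
  iter (k %% period q n) (@shift _)
    (on_sequences_upto (iter (k %/ period q n) (@shift (A n)) x)).
Proof. by rewrite on_sequences_upto_iter_shift -iterD addnC -divn_eq. Qed.

Lemma continuous_on_sequences_upto n : continuous (@on_sequences_upto n).
Proof.
elim: n => [|n IHn] x; first exact: cvg_id.
apply: (@continuous_comp _ _ _ (on_sequences (theta n)) (@on_sequences_upto n)).
  exact: (continuous_on_sequences (@size_theta n)).
exact: IHn.
Qed.

Lemma level_shift_on_sequences_upto n x :
  level_shift theta n x -> level_shift theta 0 (on_sequences_upto x).
Proof.
elim: n x => //= n IHn x Xx; apply: IHn.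
exact: (level_shift_on_sequences q_gt0 size_theta).
Qed.

(** This is sigma^r C_n with [r] not restricted to r < p_n, so that a shift merely increments
    [r]. *)
Definition tower n r : set (fullshift (A 0)) :=
  [set iter r (@shift _) (on_sequences_upto x) | x in level_shift theta n].

Lemma tower_subset n r : tower n r `<=` level_shift theta 0.
Proof.
move=> _ [x Xx <-]; rewrite level_shift_iter_shift.
exact: level_shift_on_sequences_upto.
Qed.

Lemma closed_tower n r : closed (tower n r).
Proof.
apply: compact_closed; first exact: hausdorff_fullshift.
apply: continuous_compact; last exact: compact_level_shift.
apply: continuous_subspaceT => x; apply: continuous_comp.
  exact: continuous_on_sequences_upto.
exact: continuous_iter_shift.
Qed.

Lemma tower_mod n r y : tower n r y -> tower n (r %% period q n) y.
Proof.
move=> [x Xx <-]; exists (iter (r %/ period q n) (@shift _) x).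
  by rewrite level_shift_iter_shift.
by rewrite -iter_shift_on_sequences_upto.
Qed.

Lemma tower_shift n r y : tower n r y -> tower n r.+1 (shift y).
Proof. by move=> [x Xx <-]; exists x. Qed.

Lemma tower_succ n r : tower n.+1 r `<=` tower n r.
Proof.
move=> _ [x Xx <-]; exists (on_sequences (theta n) x) => //.
exact: (level_shift_on_sequences q_gt0 size_theta).
Qed.

Lemma tower_decr m n r : (n <= m)%N -> tower m r `<=` tower n r.
Proof.
move=> /subnKC <-; elim: (m - n)%N => [|k IHk]; first by rewrite addn0.
by rewrite addnS; apply: subset_trans IHk; exact: tower_succ.
Qed.

Hypothesis minimal_X : forall n, minimal (level_shift theta n).

Lemma tower_nonempty n r : tower n r !=set0.
Proof. by have [[x Xx] _] := minimal_X n; eexists; exists x. Qed.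

(** The union is closed, as a finite union of compact sets in a Hausdorff space, and it is non-empty
    and shift-invariant. Minimality of X^(0) then applies. *)
Lemma tower_cover n :
  level_shift theta 0 = \bigcup_(r < period q n) tower n r.
Proof.
have [_ minX] := minimal_X 0; apply/esym/minX.
- by move=> y [r _]; exact: tower_subset.
- by apply: closed_bigcup => [|r _]; [exact: finite_II|exact: closed_tower].
- apply/seteqP; split=> y.
    move=> [z [r _ zr] <-]; exists (r.+1 %% period q n)%N.
      by rewrite /= ltn_pmod ?period_gt0.
    exact/tower_mod/tower_shift.
  move=> [r _ yr].
  (* Adding p_n makes the exponent positive even when r = 0, so that one shift can be split off. The
     added p_n is compensated by moving the level-n sequence back by one. *)
  have : tower n (r + period q n).-1.+1 y.
    rewrite prednK ?addn_gt0 ?period_gt0 ?orbT//.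
    move: yr => [x Xx <-].
    have x'E : iter 1 (@shift _) (fun i => x (i - 1)) = x.
      by apply: funext => i; rewrite iter_shiftE addrK.
    exists (fun i => x (i - 1)); first by rewrite -(level_shift_iter_shift _ 1) x'E.
    by rewrite -[in RHS]x'E on_sequences_upto_iter_shift mul1n iterD.
  move=> [x Xx <-]; rewrite iterS; apply: imageP.
  exists ((r + period q n).-1 %% period q n)%N; first by rewrite /= ltn_pmod ?period_gt0.
  by apply: tower_mod; exists x.
- have [y yr] := tower_nonempty n 0.
  by exists y, 0%N => //=; exact: period_gt0.
Qed.

(** * From recognizability to a factor map onto the odometer *)

(** Recognizability passes to theta^[0,n), by induction. The induction hypothesis identifies the
    exponents modulo p_n and the level-n sequences. The quotients by p_n are then the exponents of
    two centred theta^(n)-representations of one sequence. *)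
Lemma on_sequences_upto_recognizable n x x' r s : recognizable theta ->
  level_shift theta n x -> level_shift theta n x' ->
  (r < period q n)%N -> (s < period q n)%N ->
  iter r (@shift _) (on_sequences_upto x) =
  iter s (@shift _) (on_sequences_upto x') -> r = s /\ x = x'.
Proof.
move=> rec_theta; elim: n x x' r s => [|n IHn] x x' r s Xx Xx'.
  by rewrite /period big_ord0 !ltnS !leqn0 => /eqP-> /eqP->.
rewrite periodS mulnC => rp sp /=.
rewrite (iter_shift_on_sequences_upto r) (iter_shift_on_sequences_upto s).
have Xsub z k : level_shift theta n.+1 z -> level_shift theta n
    (iter k (@shift _) (on_sequences (theta n) z)).
  by rewrite level_shift_iter_shift; exact: (level_shift_on_sequences q_gt0 size_theta).
move=> /IHn[]; rewrite ?ltn_pmod ?period_gt0//; [exact: Xsub..|].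
move=> rs xx'; rewrite (divn_eq r (period q n)) (divn_eq s (period q n)) rs.
suff [-> ->] : (r %/ period q n, x)%N = (s %/ period q n, x')%N by [].
apply: (rec_theta n (iter (r %/ period q n) (@shift _)
                          (on_sequences (theta n) x))).
- by split=> //; rewrite size_theta ltn_divLR ?period_gt0.
- by split=> //; rewrite size_theta ltn_divLR ?period_gt0.
Qed.

(** The value 0 is a default for [y] outside all towers. On X^(0) some [r] exists by [tower_cover],
    and recognizability makes it unique. *)
Definition residue (y : fullshift (A 0)) : residues q := fun n =>
  xget (Ordinal (period_gt0 n)) [set r : 'I_(period q n) | tower n r y].

Lemma residueP n y : level_shift theta 0 y -> tower n (residue y n) y.
Proof.
rewrite (tower_cover n) => -[r rp yr]; rewrite /residue.
by case: xgetP => [_ _ //|/(_ (Ordinal rp))].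
Qed.

Lemma residueE n r y : recognizable theta -> tower n r y ->
  residue y n = (r %% period q n)%N :> nat.
Proof.
move=> rec_theta yr; have Xy := tower_subset yr.
have [x Xx xy] := residueP n Xy; have [x' Xx' x'y] := tower_mod yr.
have [] // := on_sequences_upto_recognizable rec_theta Xx Xx' (ltn_ord _)
  (ltn_pmod r (period_gt0 n)) (etrans xy (esym x'y)).
Qed.

Lemma residue_factor_map : recognizable theta ->
  factor_map (level_shift theta 0) (@shift _) (odometer q) (@add_one q) residue.
Proof.
move=> rec_theta; split.
- apply/subspace_continuousP => y Xy.
  apply: (@cvg_to_discrete_product _ _ (fun n => 'I_(period q n))) => n.
  (* Coordinate n is locally constant on X^(0): the finitely many towers that avoid [y] form a
     closed set, off which the coordinate equals that of [y]. *)
  pose others := \bigcup_(r in [set r | (r < period q n)%N /\ r <> residue y n])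
    tower n r.
  have closed_others : closed others.
    apply: closed_bigcup => [|r _]; last exact: closed_tower.
    by apply: sub_finite_set (finite_II (period q n)) => r [].
  have y_others : ~ others y.
    by move=> [r [rp ry] /(residueE rec_theta)]; rewrite modn_small// => /esym.
  have : nbhs y (~` others).
    by apply: open_nbhs_nbhs; split=> //; exact: closed_openC.
  apply: filterS => z z_others Xz; apply: val_inj; apply: contrapT => zy.
  by apply: z_others; exists (residue z n); [split=> //=|exact: residueP].
- apply/seteqP; split=> [_ [y Xy <-] n|z zq].
    apply/esym/(residueE rec_theta)/(tower_succ (@residueP n.+1 y Xy)).
  have zE m n : (n <= m)%N -> (z m %% period q n)%N = z n.
    move=> /subnKC <-; elim: (m - n)%N => [|k IHk].
      by rewrite addn0 modn_small.
    by rewrite addnS -IHk -(zq (n + k)%N) modn_dvdm// dvdn_period.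
  (* For surjectivity, pick a point in each tower prescribed by [z]; a cluster point of these is a
     preimage of [z]. *)
  have tz n : tower n (z n) !=set0 by exact: tower_nonempty.
  have [y_ yz] := choice tz.
  have [y [Xy yclus]] : level_shift theta 0 `&` cluster (y_ @ \oo) !=set0.
    apply: compact_level_shift; exists 0%N => // n _.
    exact: tower_subset (yz n).
  exists y => //; apply: functional_extensionality_dep => n; apply: val_inj => /=.
  rewrite (residueE (r := z n) rec_theta) ?modn_small//.
  (* By compatibility of [z] and since towers decrease with the level, the closed tower at level n
     contains every [y_ m] with n <= m, hence the cluster point. *)
  apply: closed_tower => B yB; apply: yclus => //.
  exists n => // m /= nm.
  have := tower_decr nm (yz m) => /tower_mod; rewrite zE//.
- move=> y Xy; apply: functional_extensionality_dep => n; apply: val_inj => /=.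
  by rewrite (residueE rec_theta (tower_shift (@residueP n y Xy))).
Qed.

(** * From a factor map and injectivity on letters to recognizability *)

Section FactorMap.
Variable f : fullshift (A 0) -> residues q.
Hypothesis f_factor : factor_map (level_shift theta 0) (@shift _)
  (odometer q) (@add_one q) f.

Lemma factor_map_iter_shift k y n : level_shift theta 0 y ->
  f (iter k (@shift _) y) n = ((f y n + k) %% period q n)%N :> nat.
Proof.
have [_ _ f_shift] := f_factor; move=> Xy.
rewrite -iter_ordS -iter_add_one; congr (nat_of_ord (_ n)).
by elim: k => //= k <-; apply: f_shift; rewrite level_shift_iter_shift.
Qed.

(** One shift at level n is p_n shifts at level 0, which add p_n, that is 0, to coordinate n of [f].
    The points of X^(n) with the same value as [x'] thus form a closed shift-invariant set
    containing [x'], and minimality makes it all of X^(n). *)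
Lemma factor_map_on_sequences_upto n x x' :
  level_shift theta n x -> level_shift theta n x' ->
  f (on_sequences_upto x) n = f (on_sequences_upto x') n.
Proof.
move=> Xx Xx'; have [f_cont _ _] := f_factor.
pose Y := [set z | level_shift theta n z /\
  f (on_sequences_upto z) n = f (on_sequences_upto x') n].
suff YX : Y = level_shift theta n by move: Xx; rewrite -YX => -[].
have f_shift z : level_shift theta n z ->
    f (on_sequences_upto (shift z)) n = f (on_sequences_upto z) n.
  move=> Xz; apply: val_inj => /=.
  have -> : on_sequences_upto (shift z) =
      iter (period q n) (@shift _) (on_sequences_upto z).
    by rewrite -[period q n]mul1n -on_sequences_upto_iter_shift.
  rewrite factor_map_iter_shift; last exact: level_shift_on_sequences_upto.
  by rewrite modnDr modn_small.
have shiftY z : Y (shift z) <-> Y z.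
  by rewrite /Y /= level_shift_shift; split=> -[Xz <-]; rewrite f_shift.
have [_ minX] := minimal_X n; apply: minX.
- by move=> z [].
- move=> z Yz.
  have Xz : level_shift theta n z.
    by apply: closed_level_shift => B /Yz[w [[Xw _] Bw]]; exists w.
  split=> //; have Xuz := level_shift_on_sequences_upto Xz.
  (* Continuity of [f] holds only within X^(0), so the nearby point [w] must be shown to have its
     image there. *)
  move/subspace_continuousP : f_cont => /(_ _ Xuz) f_cont.
  have f_near := f_cont _ (near_coordinate (K := fun n => 'I_(period q n)) _ n).
  have [w [[Xw <-] fw]] := Yz _ (continuous_on_sequences_upto f_near).
  exact/esym/fw/level_shift_on_sequences_upto.
- apply/seteqP; split=> z; first by move=> [w Yw <-]; exact/shiftY.
  have zE : shift (fun i => z (i - 1)) = z.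
    by apply: funext => i; rewrite /shift addrK.
  by move=> Yz; exists (fun i => z (i - 1)) => //; apply/shiftY; rewrite zE.
- by exists x'.
Qed.

Lemma factor_map_recognizable : (forall n, injective (theta n)) ->
  recognizable theta.
Proof.
move=> theta_inj n y [k x] [k' x'] [/= Xx yx kq] [/= Xx' yx' kq'].
rewrite !size_theta in kq kq'.
(* Applying theta^[0,n) turns [j] shifts into j p_n shifts, visible in coordinate n + 1 modulo
   p_(n+1) = p_n q_n. *)
have fE j z : level_shift theta n.+1 z ->
    f (on_sequences_upto (iter j (@shift _) (on_sequences (theta n) z))) n.+1 =
    ((f (@on_sequences_upto n.+1 z) n.+1 + j * period q n)
      %% period q n.+1)%N :> nat.
  move=> Xz; rewrite on_sequences_upto_iter_shift factor_map_iter_shift//.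
  exact: (@level_shift_on_sequences_upto n.+1).
(* The starting values agree because coordinate n + 1 is constant on C_(n+1). What remains is k p_n
   = k' p_n modulo p_n q_n, where both sides are below the modulus. *)
have kk' : k = k'.
  have := fE k' x' Xx'; rewrite -yx' yx fE// (factor_map_on_sequences_upto Xx Xx').
  move/eqP; rewrite eqn_modDl periodS !modn_small; last first.
  - by rewrite mulnC ltn_pmul2l ?period_gt0.
  - by rewrite mulnC ltn_pmul2l ?period_gt0.
  by rewrite eqn_pmul2r ?period_gt0// => /eqP.
rewrite kk'; congr (_, _); apply: (on_sequences_inj (@size_theta n) (q_gt0 n)) => //.
by apply: (@iter_shift_inj _ k'); rewrite -yx' yx kk'.
Qed.
End FactorMap.

End Towers.

Theorem lemma7 (A : nat -> finType) (theta : directive_sequence A)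
  (q : nat -> nat)
  (bounded_A : bounded_alphabets A)
  (length_q : constant_length theta q)
  (q_ge2 : forall m : nat, exists n : nat, (m <= n)%N /\ (2 <= q n)%N)
  (minimal_X : forall n : nat, minimal (level_shift theta n)) :
  (recognizable theta -> quasi_recognizable theta q) /\
  (quasi_recognizable theta q ->
   (forall n : nat, injective (theta n)) ->
   recognizable theta).
Proof.
(* A point of X^(n+1) supplies a letter, and q_n is the length of its non-empty image. *)
have q_gt0 n : (0 < q n)%N.
  have [[x _] _] := minimal_X n.+1.
  by rewrite -(length_q n (x 0)) morphism_gt0.
split=> [rec_theta|[f f_factor]].
  by exists (residue theta q_gt0); exact: residue_factor_map.
exact: (factor_map_recognizable length_q q_gt0 minimal_X f_factor).
Qed.
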